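(* Let $p$ be a prime and let $(A,+,\cdot)$ be a pre-Lie algebra over $\mathbb{F}_p$ with $(A,+)\cong C_p^5$, generated by a single element $x$ as a pre-Lie algebra. Suppose $A^{[5]}\neq 0$, $A^{[6]}=0$ and $A^{[5]}=A^{[4]}$. Then the following hold. (1) $\{x,\ x^2,\ x^2\cdot x,\ x\cdot x^2,\ x^2\cdot(x^2\cdot x)\}$ forms a basis of $A$ as an $\mathbb{F}_p$-vector space. (2) $A^{[3]}/A^{[4]}=\mathbb{F}_p\,x\cdot x^2+\mathbb{F}_p\,x^2\cdot x$ and $A^{[4]}=A^{[5]}=\mathbb{F}_p\,x^2\cdot(x^2\cdot x)$. (3) The only non-zero product of $5$ or more elements in $A$ is $x^2\cdot(x^2\cdot x)$.
   Context: A pre-Lie algebra over $\mathbb{F}_p$ is an $\mathbb{F}_p$-vector space $A$ with a bilinear product $\cdot$ satisfying $(a\cdot b)\cdot c-a\cdot(b\cdot c)=(b\cdot a)\cdot c-b\cdot(a\cdot c)$ for all $a,b,c\in A$. $C_p$ denotes the cyclic group of order $p$. For subspaces $B,C\subseteq A$, $B\cdot C$ denotes the subspace spanned by all $b\cdot c$ with $b\in B$, $c\in C$. Define $A^{[1]}=A$ and $A^{[i+1]}=\sum_{j=1}^{i}A^{[j]}\cdot A^{[i+1-j]}$ for $i\ge 1$. Write $x^2=x\cdot x$. The notation $A^{[3]}/A^{[4]}=\mathbb{F}_p\,a+\mathbb{F}_p\,b$ means that the quotient is spanned over $\mathbb{F}_p$ by the images of $a,b\in A^{[3]}$. *)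

(* Defs.v *)
From HB Require Import structures.
From mathcomp Require Import all_boot all_order all_algebra.

Set Implicit Arguments.
Unset Strict Implicit.
Unset Printing Implicit Defensive.

Import GRing.Theory.

Local Open Scope ring_scope.

Declare Scope prelie_scope.
Delimit Scope prelie_scope with PL.

(* Finite-dimensional (left) pre-Lie algebras over a field; the product is not
   assumed to be associative. *)
HB.mixin Record Vector_isPreLie (F : fieldType) A of Vector F A := {
  plmul : A -> A -> A;
  plmul_linearl : forall c : A, linear (fun a : A => plmul a c);
  plmul_linearr : forall a : A, linear (fun c : A => plmul a c);
  plmul_preLie : forall a b c : A,
    plmul (plmul a b) c - plmul a (plmul b c)
    = plmul (plmul b a) c - plmul b (plmul a c)
}.

#[short(type="preLieAlgType")]
HB.structure Definition PreLie (F : fieldType) :=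
  {A of Vector_isPreLie F A & Vector F A}.

Notation "a ** b" := (plmul a b) (at level 40, left associativity)
  : prelie_scope.

Local Open Scope prelie_scope.

Section PreLieTheory.
Variables (F : fieldType) (A : preLieAlgType F).
Implicit Types (U V W B C : {vspace A}) (a b c x : A).

Definition generated_by x : Prop :=
  forall U : {vspace A},
    x \in U -> {in U &, forall u v, u ** v \in U} -> U = fullv.

(* The subspace B . C.  Products of basis vectors suffice by bilinearity, and
   vmulP shows that this is the least subspace containing all b ** c. *)
Definition vmul B C : {vspace A} :=
  <<[seq b ** c | b <- vbasis B, c <- vbasis C]>>%VS.

Lemma vmulP B C U :
  reflect (forall b c, b \in B -> c \in C -> b ** c \in U) (vmul B C <= U)%VS.
Proof.
apply: (iffP idP) => [sBCU b c Bb Cc|sBCU]; last first.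
  by apply/span_subvP => _ /allpairsP[[b c] /= [Bb Cc ->]];
    apply: sBCU; apply: vbasis_mem.
have fl_sum v n (k : 'I_n -> F) (e : 'I_n -> A) :
    (\sum_i k i *: e i) ** v = \sum_i k i *: (e i ** v).
  elim/big_rec2: _ => [|i y1 y2 _ <-]; last exact: plmul_linearl.
  by have := plmul_linearl v (-1) 0 0; rewrite !scaleN1r !addNr.
have fr_sum u n (k : 'I_n -> F) (e : 'I_n -> A) :
    u ** (\sum_i k i *: e i) = \sum_i k i *: (u ** e i).
  elim/big_rec2: _ => [|i y1 y2 _ <-]; last exact: plmul_linearr.
  by have := plmul_linearr u (-1) 0 0; rewrite !scaleN1r !addNr.
apply: (subvP sBCU); rewrite (coord_vbasis Bb) (coord_vbasis Cc) fl_sum.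
apply: rpred_sum => i _; apply: rpredZ; rewrite fr_sum.
apply: rpred_sum => j _; apply/rpredZ/memv_span/allpairsP.
by exists ((vbasis B)`_i, (vbasis C)`_j); rewrite !mem_nth ?size_tuple.
Qed.

(* plpows n = [:: A^[1]; ...; A^[n]], so that the entry of index j is
   A^[j + 1]; see plpow1 and plpowS for the usual recursion. *)
Fixpoint plpows (n : nat) : seq {vspace A} :=
  if n is m.+1 then
    let s := plpows m in
    rcons s (if m is 0 then fullv
             else \sum_(j < m) vmul (nth 0 s j) (nth 0 s (m - j.+1)))%VS
  else [::].

(* A^[i], meaningful for 1 <= i only. *)
Definition plpow (i : nat) : {vspace A} := nth 0%VS (plpows i) i.-1.

Lemma size_plpows n : size (plpows n) = n.
Proof. by elim: n => //= n IHn; rewrite size_rcons IHn. Qed.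

Lemma nth_plpows n i : (i < n)%N -> nth 0%VS (plpows n) i = plpow i.+1.
Proof.
elim: n => // n IHn; rewrite ltnS leq_eqVlt => /predU1P[-> // | lt_in].
by rewrite /= nth_rcons size_plpows lt_in IHn.
Qed.

Lemma plpow1 : plpow 1 = fullv.
Proof. by []. Qed.

Lemma plpowS i : (0 < i)%N ->
  plpow i.+1 = (\sum_(1 <= j < i.+1) vmul (plpow j) (plpow (i.+1 - j)))%VS.
Proof.
case: i => // i _; rewrite {1}/plpow [plpows i.+2]/=.
rewrite -[rcons (plpows i) _]/(plpows i.+1) nth_rcons size_plpows ltnn eqxx.
rewrite big_add1 big_mkord; apply: eq_bigr => j _.
rewrite !nth_plpows ?ltn_ord // ?subSS; last by rewrite ltnS leq_subr.
by rewrite -subSn // -ltnS.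
Qed.

(* U / W = F a + F b, where W <= U and a, b are in U: modulo W, each element
   of U is a linear combination of a and b. *)
Definition quotient_spanned_by U W a b : Prop :=
  [/\ (W <= U)%VS, a \in U, b \in U &
      forall u, u \in U -> exists k l : F, u - (k *: a + l *: b) \in W].

End PreLieTheory.

(* Non-associative words, i.e., the free magma on T. *)
Inductive word (T : Type) : Type :=
| Letter of T
| Prod of word T & word T.

Fixpoint word_length T (w : word T) : nat :=
  match w with
  | Letter _ => 1
  | Prod u v => word_length u + word_length v
  end.

Fixpoint word_eval (F : fieldType) (A : preLieAlgType F) T (f : T -> A)
    (w : word T) : A :=
  match w with
  | Letter t => f t
  | Prod u v => word_eval f u ** word_eval f v
  end.

(* The word (a b)((c d) e). *)
Definition word5 T (a b c d e : T) : word T :=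
  Prod (Prod (Letter a) (Letter b))
       (Prod (Prod (Letter c) (Letter d)) (Letter e)).

(* A product of n elements is the value of a word of length n.  The first part
   concerns products of copies of x, i.e., words in one letter.  The second part
   concerns products of arbitrary elements of A: as (k x)^2 ((k x)^2 (k x)) is
   k^5 times x^2 (x^2 x), uniqueness can only hold up to a scalar. *)
Definition only_nonzero_long_product (F : fieldType) (A : preLieAlgType F)
    (x : A) : Prop :=
  (forall w : word unit, (5 <= word_length w)%N ->
     word_eval (fun=> x) w <> 0 <-> w = word5 tt tt tt tt tt)
  /\
  (forall w : word A, (5 <= word_length w)%N -> word_eval id w <> 0 ->
     (exists a b c d e : A, w = word5 a b c d e)
     /\ exists k : F, word_eval id w = k *: ((x ** x) ** ((x ** x) ** x))).

(* Main.v *)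
Require Import Defs.
From HB Require Import structures.
From mathcomp Require Import all_boot all_order all_algebra.

(** The filtration A^[n] is decreasing and multiplicative, and if x generates A
    then A is spanned by x modulo A^[2].  Hence A^[2] is spanned by x^2 modulo
    A^[3], and A^[3] by x x^2 and x^2 x modulo A^[4]: the leading term of a
    product is the product of the leading terms ([vmul_lead]).

    The hypotheses A^[4] = A^[5] and A^[6] = 0 give A A^[4] = A^[4] A = 0, so a
    nonzero product of five elements must be of type (2, 3) or (3, 2).  The
    pre-Lie identity kills most of these.  For z in A^[3] it reads
      (a z) b - a (z b) = (z a) b - z (a b),
    where everything but z (a b) lies in A^[4] A + A A^[4] = 0; therefore
    A^[3] A^[2] = 0 ([plmul_plpow3_plpow2]).  For b and c in A^[2] it reads
      (a b) c - a (b c) = (b a) c - b (a c),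
    where everything but b (a c) lies in A^[3] A^[2] + A A^[4] = 0; therefore
    A^[2] (A A^[2]) = 0 ([plmul_plpow2_1_plpow2]).  Only the shape
    (a b)((c d) e) survives, and its leading term is x^2 (x^2 x), so that
    A^[5] is the line of this element.

    Consequently x, x^2, x^2 x, x x^2 and x^2 (x^2 x) span A; as A has p^5
    elements its dimension is 5, and these five vectors form a basis. *)

Set Implicit Arguments.
Unset Strict Implicit.
Unset Printing Implicit Defensive.

Import GRing.Theory VectorInternalTheory.

Local Open Scope ring_scope.
Local Open Scope prelie_scope.

(** * Words of length one and two *)

Lemma word_length_gt0 T (w : word T) : (0 < word_length w)%N.
Proof. by elim: w => //= u IHu v _; rewrite addn_gt0 IHu. Qed.

Lemma word_length1 T (w : word T) : word_length w = 1%N ->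
  exists a, w = Letter a.
Proof.
case: w => [a|u v /= uv1]; first by exists a.
have := word_length_gt0 u; have := word_length_gt0 v.
by move: uv1; case: (word_length u) => [|m]; case: (word_length v) => [|n];
  rewrite // addnS.
Qed.

Lemma word_length2 T (w : word T) : word_length w = 2%N ->
  exists a b, w = Prod (Letter a) (Letter b).
Proof.
case: w => //= u v uv2; have := word_length_gt0 u; have := word_length_gt0 v.
move: uv2; case Du: (word_length u) => [|[|m]]; rewrite ?addSn // => -[].
  by move=> Dv _ _; have [a ->] := word_length1 Du;
    have [b ->] := word_length1 Dv; exists a, b.
by case: (word_length v) => // n; rewrite addnS.
Qed.

(** * Products of subspaces and the filtration *)

Section Filtration.
Variables (F : fieldType) (A : preLieAlgType F).
Implicit Types (U V W B C : {vspace A}) (a b c x : A).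

Lemma plmulDl a b c : (a + b) ** c = a ** c + b ** c.
Proof. by have := plmul_linearl c 1 a b; rewrite !scale1r. Qed.

Lemma plmulDr a b c : c ** (a + b) = c ** a + c ** b.
Proof. by have := plmul_linearr c 1 a b; rewrite !scale1r. Qed.

Lemma plmul0l a : 0 ** a = 0.
Proof. by apply: (addrI (0 ** a)); rewrite -plmulDl !addr0. Qed.

Lemma plmulr0 a : a ** 0 = 0.
Proof. by apply: (addrI (a ** 0)); rewrite -plmulDr !addr0. Qed.

Lemma plmulZl k a c : (k *: a) ** c = k *: (a ** c).
Proof. by have := plmul_linearl c k a 0; rewrite plmul0l !addr0. Qed.

Lemma plmulZr k a c : a ** (k *: c) = k *: (a ** c).
Proof. by have := plmul_linearr a k c 0; rewrite plmulr0 !addr0. Qed.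

Lemma memv_vmul B C b c : b \in B -> c \in C -> b ** c \in vmul B C.
Proof. exact: (elimT (vmulP B C _) (subvv _)). Qed.

(** The right annihilator of z is a subspace. *)
Lemma plmul_vmul_eq0 B C z :
  (forall b c, b \in B -> c \in C -> z ** (b ** c) = 0) ->
  forall c, c \in vmul B C -> z ** c = 0.
Proof.
move=> zBC.
pose g : {linear A -> A} :=
  HB.pack (plmul z) (GRing.isLinear.Build _ _ _ _ _ (plmul_linearr z)).
have sBC : (vmul B C <= lker (linfun g))%VS.
  by apply/vmulP => b c Bb Cc; rewrite memv_ker lfunE /= zBC.
by move=> c /(subvP sBC); rewrite memv_ker lfunE => /eqP.
Qed.

Lemma vmul_plpow_sub i j : (0 < i)%N -> (0 < j)%N ->
  (vmul (plpow A i) (plpow A j) <= plpow A (i + j))%VS.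
Proof.
case: i => // i _ j_gt0.
rewrite addSn [X in (_ <= X)%VS]plpowS ?addn_gt0 ?j_gt0 ?orbT //.
have iP : (i.+1 \in index_iota 1 (i + j).+1)%N.
  by rewrite mem_index_iota ltnS -addn1 leq_add2l.
by rewrite (big_rem _ iP) /= -addSn addKn addvSl.
Qed.

Lemma plmul_plpow i j a b : (0 < i)%N -> (0 < j)%N ->
  a \in plpow A i -> b \in plpow A j -> a ** b \in plpow A (i + j).
Proof.
move=> i_gt0 j_gt0 Aa Ab.
by apply/(subvP (vmul_plpow_sub i_gt0 j_gt0))/memv_vmul.
Qed.

Lemma plpowS_subP i U : (0 < i)%N ->
  (forall j b c, (0 < j)%N -> (j <= i)%N ->
     b \in plpow A j -> c \in plpow A (i.+1 - j) -> b ** c \in U) ->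
  (plpow A i.+1 <= U)%VS.
Proof.
move=> i_gt0 AU; rewrite plpowS // big_seq.
apply: (big_ind (fun W => W <= U)%VS) => [|V W VU WU|j]; first exact: sub0v.
  by rewrite subv_add VU.
rewrite mem_index_iota ltnS => /andP[j_gt0 le_j_i].
by apply/vmulP => b c; apply: AU.
Qed.

(** In each product A^[j] A^[n+1-j] one of the two factors has degree at least
    2 once n >= 2, and by induction that factor can be weakened by one degree. *)
Lemma plpowS_sub n : (0 < n)%N -> (plpow A n.+1 <= plpow A n)%VS.
Proof.
have [m] := ubnP n; elim: m n => // m IHm [|[|n]] // lt_n_m _.
  by rewrite plpow1 subvf.
apply: plpowS_subP => // -[|[|j]] // b c _ le_j Ab Ac.
  rewrite -[n.+2]add1n; apply: plmul_plpow => //.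
  by apply: (subvP (IHm n.+1 _ _)) => //; rewrite subn1 in Ac.
have -> : (n.+2 = j.+1 + (n.+3 - j.+2))%N.
  by rewrite !subSS addSn subnKC // ltnW.
apply: plmul_plpow => //; first by rewrite subn_gt0.
apply: (subvP (IHm j.+1 _ _)) => //.
exact: leq_trans le_j lt_n_m.
Qed.

Lemma plpow_sub m n : (0 < m)%N -> (m <= n)%N -> (plpow A n <= plpow A m)%VS.
Proof.
move=> m_gt0; elim: n => [|n IHn]; first by rewrite leqNgt m_gt0.
rewrite leq_eqVlt ltnS => /predU1P[-> // | le_mn].
by apply: subv_trans (IHn le_mn); rewrite plpowS_sub // (leq_trans m_gt0).
Qed.

Lemma word_eval_plpow T (f : T -> A) (w : word T) :
  word_eval f w \in plpow A (word_length w).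
Proof.
elim: w => [t|u IHu v IHv] /=; first by rewrite plpow1 memvf.
by apply: plmul_plpow => //; apply: word_length_gt0.
Qed.

(** Modulo the next step of the filtration, a product depends only on the
    leading terms b and c of its factors. *)
Lemma vmul_lead i j B C b c : (0 < i)%N -> (0 < j)%N ->
  b \in plpow A i -> c \in plpow A j ->
  (B <= <[b]> + plpow A i.+1)%VS -> (C <= <[c]> + plpow A j.+1)%VS ->
  (vmul B C <= <[b ** c]> + plpow A (i + j).+1)%VS.
Proof.
move=> i_gt0 j_gt0 Ab Ac sB sC; apply/vmulP => b1 c1.
move=> /(subvP sB) Bb1 /(subvP sC).
have /memv_addP[_ /vlineP[k ->] [b' Ab' ->]] := Bb1.
case/memv_addP=> _ /vlineP[l ->] [c' Ac' ->].
rewrite plmulDl plmulDr -addrA memv_add //.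
  by rewrite plmulZl plmulZr !memvZ ?memv_line.
rewrite memvD //; first by rewrite -addnS plmul_plpow ?memvZ.
rewrite -addSn plmul_plpow // memvD ?memvZ //.
exact: (subvP (plpowS_sub j_gt0)).
Qed.

(** The subspace F x + A^[2] contains every product, hence is a subalgebra. *)
Lemma generated_by_lead x : generated_by x ->
  ({:A} <= <[x]> + plpow A 2)%VS.
Proof.
move=> /(_ (<[x]> + plpow A 2)%VS) -> //.
  by rewrite (subvP (addvSl _ _)) ?memv_line.
move=> u v _ _; apply: (subvP (addvSr _ _)).
by apply: (@plmul_plpow 1 1); rewrite // plpow1 memvf.
Qed.

Lemma plpow2_lead x : generated_by x ->
  (plpow A 2 <= <[x ** x]> + plpow A 3)%VS.
Proof.
move=> x_gen; rewrite [X in (X <= _)%VS]plpowS // big_nat1 plpow1.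
by apply: (@vmul_lead 1 1); rewrite ?plpow1 ?memvf ?generated_by_lead.
Qed.

Lemma plpow3E : plpow A 3 = (vmul {:A} (plpow A 2) + vmul (plpow A 2) {:A})%VS.
Proof. by rewrite plpowS // big_nat_recr //= big_nat1 plpow1. Qed.

Lemma sqr_plpow2 x : x ** x \in plpow A 2.
Proof. by apply: (@plmul_plpow 1 1); rewrite ?plpow1 ?memvf. Qed.

Lemma vmul_plpow2_1_lead x : generated_by x ->
  (vmul (plpow A 2) {:A} <= <[(x ** x) ** x]> + plpow A 4)%VS.
Proof.
move=> x_gen; apply: (@vmul_lead 2 1); rewrite ?plpow1 ?memvf ?sqr_plpow2 //.
  exact: plpow2_lead.
exact: generated_by_lead.
Qed.

Lemma plpow3_lead x : generated_by x ->
  (plpow A 3 <= <[x ** (x ** x)]> + <[(x ** x) ** x]> + plpow A 4)%VS.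
Proof.
move=> x_gen; rewrite plpow3E subv_add; apply/andP; split; last first.
  by rewrite (subv_trans (vmul_plpow2_1_lead x_gen)) // addvS // addvSr.
apply: (@subv_trans _ _ (<[x ** (x ** x)]> + plpow A 4)%VS).
  apply: (@vmul_lead 1 2); rewrite ?plpow1 ?memvf ?sqr_plpow2 //.
    exact: generated_by_lead.
  exact: plpow2_lead.
by rewrite addvS // addvSl.
Qed.

End Filtration.

(** * Products of degree five *)

Section DegreeFive.
Variables (F : fieldType) (A : preLieAlgType F).
Hypotheses (A6_eq0 : plpow A 6 = 0%VS) (A5_eq_A4 : plpow A 5 = plpow A 4).

Lemma plmul_plpow4r (a b : A) : b \in plpow A 4 -> a ** b = 0.
Proof.
rewrite -A5_eq_A4 => Ab; apply/eqP; rewrite -memv0 -A6_eq0.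
by apply: (@plmul_plpow _ _ 1 5); rewrite ?plpow1 ?memvf.
Qed.

Lemma plmul_plpow4l (a b : A) : a \in plpow A 4 -> a ** b = 0.
Proof.
rewrite -A5_eq_A4 => Aa; apply/eqP; rewrite -memv0 -A6_eq0.
by apply: (@plmul_plpow _ _ 5 1); rewrite ?plpow1 ?memvf.
Qed.

(** The pre-Lie identity for a, z, b expresses z (a b) through products having
    a factor in A^[4]. *)
Lemma plmul_plpow3_plpow2 (z c : A) :
  z \in plpow A 3 -> c \in plpow A 2 -> z ** c = 0.
Proof.
move=> Az; rewrite plpowS // big_nat1 plpow1; apply: plmul_vmul_eq0 => a b _ _.
have Aza : z ** a \in plpow A 4.
  by apply: (@plmul_plpow _ _ 3 1); rewrite ?plpow1 ?memvf.
have Azb : z ** b \in plpow A 4.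
  by apply: (@plmul_plpow _ _ 3 1); rewrite ?plpow1 ?memvf.
have Aaz : a ** z \in plpow A 4.
  by apply: (@plmul_plpow _ _ 1 3); rewrite ?plpow1 ?memvf.
have := plmul_preLie a z b.
rewrite (plmul_plpow4l _ Aaz) (plmul_plpow4r _ Azb) (plmul_plpow4l _ Aza).
by rewrite subrr sub0r => /esym/eqP; rewrite oppr_eq0 => /eqP.
Qed.

(** The pre-Lie identity for a, b, c expresses b (a c) through products lying
    in A^[3] A^[2] or in A A^[4]. *)
Lemma plmul_plpow2_1_plpow2 (b z : A) :
  b \in plpow A 2 -> z \in vmul {:A} (plpow A 2) -> b ** z = 0.
Proof.
move=> Ab; apply: plmul_vmul_eq0 => a c _ Ac.
have Aab : a ** b \in plpow A 3.
  by apply: (@plmul_plpow _ _ 1 2); rewrite ?plpow1 ?memvf.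
have Aba : b ** a \in plpow A 3.
  by apply: (@plmul_plpow _ _ 2 1); rewrite ?plpow1 ?memvf.
have Abc : b ** c \in plpow A 4 by apply: (@plmul_plpow _ _ 2 2).
have := plmul_preLie a b c.
rewrite (plmul_plpow3_plpow2 Aab Ac) (plmul_plpow3_plpow2 Aba Ac).
rewrite (plmul_plpow4r _ Abc) subrr sub0r => /esym/eqP.
by rewrite oppr_eq0 => /eqP.
Qed.

(** Of the four products A^[j] A^[5-j] only A^[2] A^[3] can be nonzero, and
    there the part A A^[2] of A^[3] does not contribute. *)
Lemma plpow5_sub : (plpow A 5 <= vmul (plpow A 2) (vmul (plpow A 2) {:A}))%VS.
Proof.
apply: plpowS_subP => // -[|[|[|[|[|j]]]]] // b c _ _ Ab Ac.
- by rewrite plmul_plpow4r ?mem0v.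
- move: Ac; rewrite [(_ - _)%N]/= plpow3E => /memv_addP[c1 Ac1 [c2 Ac2 ->]].
  by rewrite plmulDr plmul_plpow2_1_plpow2 // add0r memv_vmul.
- by rewrite plmul_plpow3_plpow2 ?mem0v.
- by rewrite plmul_plpow4l ?mem0v.
Qed.

Lemma plpow5_sub_line x : generated_by x ->
  (plpow A 5 <= <[(x ** x) ** ((x ** x) ** x)]>)%VS.
Proof.
move=> x_gen; apply: subv_trans plpow5_sub _.
rewrite -[X in (_ <= X)%VS]addv0 -A6_eq0; apply: (@vmul_lead _ _ 2 3) => //.
- exact: sqr_plpow2.
- by apply: (@plmul_plpow _ _ 2 1); rewrite ?plpow1 ?memvf ?sqr_plpow2.
- exact: plpow2_lead.
- exact: vmul_plpow2_1_lead.
Qed.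

(** By the vanishing lemmas above, cutting a word of length 5 at its root leaves
    only the lengths 2 + 3, and the factor of length 3 must have its longer
    half on the left. *)
Lemma word_eval_long_neq0 T (f : T -> A) (w : word T) :
  (5 <= word_length w)%N -> word_eval f w <> 0 ->
  word_eval f w \in plpow A 5 /\ exists a b c d e, w = word5 a b c d e.
Proof.
move=> ge5 w_neq0; split.
  by apply: (subvP (plpow_sub A _ ge5)) => //; apply: word_eval_plpow.
have len5 : word_length w = 5%N.
  apply/eqP; rewrite eqn_leq ge5 andbT leqNgt; apply/negP => ge6.
  case: w_neq0; apply/eqP; rewrite -memv0 -A6_eq0.
  by apply: (subvP (plpow_sub A _ ge6)) => //; apply: word_eval_plpow.
case: w w_neq0 len5 {ge5} => //= u v uv_neq0 len5.
have := word_eval_plpow f u; have := word_eval_plpow f v.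
have := word_length_gt0 u; have := word_length_gt0 v.
have Dv : word_length v = (5 - word_length u)%N by rewrite -len5 addKn.
rewrite {}Dv; case Du: (word_length u) => [|[|[|[|[|n]]]]] // _ _ Av Au.
- by case: uv_neq0; rewrite plmul_plpow4r.
- have [a [b Du12]] := word_length2 Du; subst u.
  have {Du len5} Dv : word_length v = 3%N by case: len5.
  case: v Dv uv_neq0 {Av} => //= v1 v2 Dv uv_neq0.
  have := word_length_gt0 v1; have := word_length_gt0 v2.
  case Dv1: (word_length v1) Dv => [|[|[|n]]] //; rewrite ?addSn => -[Dv2].
  + move=> _ _; case: uv_neq0; apply: plmul_plpow2_1_plpow2 => //.
    by rewrite memv_vmul ?memvf // -Dv2 word_eval_plpow.
  + move=> _ _.
    have [c [d ->]] := word_length2 Dv1; have [e ->] := word_length1 Dv2.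
    by exists a, b, c, d, e.
  + by move/eqP: Dv2; rewrite addn_eq0 => /andP[_ /eqP->].
- by case: uv_neq0; rewrite plmul_plpow3_plpow2.
- by case: uv_neq0; rewrite plmul_plpow4l.
Qed.

End DegreeFive.

(** * The dimension and the theorem *)

(** Counting suffices: V has p ^ \dim V elements. *)
Lemma dim_bij_Zp_rV p n (p_prime : prime p) (V : vectType 'F_p)
    (f : V -> 'rV['Z_p]_n) : bijective f -> \dim {:V} = n.
Proof.
move=> f_bij.
have r2v_bij : bijective (@r2v _ V).
  by exists (@v2r _ V); [apply: r2vK | apply: v2rK].
have := bij_eq_card (bij_comp f_bij r2v_bij); rewrite dimvf.
rewrite !card_mx !mul1n card_Fp // card_ord (Zp_cast (prime_gt1 p_prime)).
exact: (expnI (prime_gt1 p_prime)).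
Qed.

Theorem theorem4p3p2 (p : nat) (p_prime : prime p) (A : preLieAlgType 'F_p)
    (A_Cp5 : exists f : {additive A -> 'rV['Z_p]_5}, bijective f)
    (x : A) (x_gen : generated_by x)
    (A5_neq0 : plpow A 5 <> 0%VS)
    (A6_eq0 : plpow A 6 = 0%VS)
    (A5_eq_A4 : plpow A 5 = plpow A 4) :
  [/\ basis_of fullv [:: x; x ** x; (x ** x) ** x; x ** (x ** x);
                         (x ** x) ** ((x ** x) ** x)],
      [/\ quotient_spanned_by (plpow A 3) (plpow A 4)
            (x ** (x ** x)) ((x ** x) ** x),
          plpow A 4 = plpow A 5
        & plpow A 5 = <[(x ** x) ** ((x ** x) ** x)]>%VS]
    & only_nonzero_long_product x].
Proof.
have Ax2 := sqr_plpow2 x.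
have Ax2x : (x ** x) ** x \in plpow A 3.
  by apply: (@plmul_plpow _ _ 2 1); rewrite ?plpow1 ?memvf.
have Axx2 : x ** (x ** x) \in plpow A 3.
  by apply: (@plmul_plpow _ _ 1 2); rewrite ?plpow1 ?memvf.
have sA5 := plpow5_sub_line A6_eq0 A5_eq_A4 x_gen.
have DA5 : plpow A 5 = <[(x ** x) ** ((x ** x) ** x)]>%VS.
  apply/eqP; rewrite eqEsubv sA5 -memvE.
  by apply: (@plmul_plpow _ _ 2 3).
have w_neq0 : (x ** x) ** ((x ** x) ** x) <> 0.
  by move=> w0; apply: A5_neq0; apply/eqP; rewrite DA5 w0 -subv0 -memvE mem0v.
split; [|split=> //|].
- have [f /dim_bij_Zp_rV dimA] := A_Cp5.
  rewrite basisEdim dimA // andbT.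
  apply: subv_trans (generated_by_lead x_gen) _.
  rewrite !span_cons span_nil addv0 addvS //.
  apply: subv_trans (plpow2_lead x_gen) _; rewrite addvS //.
  apply: subv_trans (plpow3_lead x_gen) _.
  by rewrite -A5_eq_A4 DA5 addvA [X in (X + _ <= _)%VS]addvC.
- split=> // [|u /(subvP (plpow3_lead x_gen))]; first exact: plpow_sub.
  case/memv_addP=> _ /memv_addP[_ /vlineP[k ->] [_ /vlineP[l ->] ->]] [r Ar ->].
  by exists k, l; rewrite addrC addKr.
- split=> w ge5; last first.
    move=> /(word_eval_long_neq0 A6_eq0 A5_eq_A4 ge5)[Aw w5]; split=> //.
    by move: Aw; rewrite DA5 => /vlineP.
  split=> [/(word_eval_long_neq0 A6_eq0 A5_eq_A4 ge5)[_]|-> //].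
  by case=> [[] [[] [[] [[] [[] ->]]]]].
Qed.
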